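(* Let $\kappa$ be a regular cardinal and let $\mathsf{A}$ be a $\kappa$-accessible category with finite products. Then the classes of $\kappa$-pure monomorphisms and strongly $\kappa$-pure monomorphisms in $\mathsf{A}$ coincide. In other words, all $\kappa$-pure monomorphisms in $\mathsf{A}$ are $\kappa$-directed colimits (in the category of morphisms $\mathsf{A}^{\to}$) of split monomorphisms between $\kappa$-presentable objects of $\mathsf{A}$.
   Context: A category $\mathsf{A}$ with $\kappa$-directed colimits is $\kappa$-accessible if there is a set of $\kappa$-presentable objects such that every object of $\mathsf{A}$ is a $\kappa$-directed colimit of objects from this set. An object $S$ is $\kappa$-presentable if $\mathrm{Hom}_{\mathsf{A}}(S,-)$ preserves $\kappa$-directed colimits. $\mathsf{A}_{<\kappa}$ denotes the full subcategory of $\kappa$-presentable objects. $\mathsf{A}^{\to}$ is the category whose objects are the morphisms in $\mathsf{A}$ and whose morphisms are the commutative squares in $\mathsf{A}$. A split monomorphism is a morphism $i\colon A\to B$ for which there is $s\colon B\to A$ with $s\circ i=\mathrm{id}_A$. A morphism $m\colon C\to D$ in $\mathsf{A}$ is a $\kappa$-pure monomorphism if for every morphism $t\colon S\to T$ in $\mathsf{A}_{<\kappa}$ and all morphisms $c\colon S\to C$, $d\colon T\to D$ with $m\circ c=d\circ t$ there exists a morphism $e\colon T\to C$ with $e\circ t=c$. A morphism $m$ in $\mathsf{A}$ is a strongly $\kappa$-pure monomorphism if it is a $\kappa$-directed colimit in $\mathsf{A}^{\to}$ of split monomorphisms between $\kappa$-presentable objects of $\mathsf{A}$. *)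

(* Defs.v *)
From mathcomp Require Import all_boot.
From mathcomp Require Import boolp classical_sets functions cardinality.

Set Implicit Arguments.
Unset Strict Implicit.
Unset Printing Implicit Defensive.

Local Open Scope classical_set_scope.
Local Open Scope card_scope.

(* One fixed universe, whose types play the role of sets: hom-sets, index
   posets, cardinals and generating sets are small, whereas the objects of a
   category may live in a strictly larger universe (see [SET]). *)
Definition SmallType := Type.

Definition card_lt (T U : Type) (A : set T) (B : set U) : Prop :=
  A #<= B /\ ~ (B #<= A).

(* A cardinal is represented by a small type having that cardinality. *)
Definition regular_cardinal (kappa : SmallType) : Prop :=
  infinite_set [set: kappa] /\
  forall (I : SmallType) (F : I -> set kappa),
    card_lt [set: I] [set: kappa] ->
    (forall i, card_lt (F i) [set: kappa]) ->
    \bigcup_i F i <> [set: kappa].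

Record category := Category {
  obj :> Type;
  hom : obj -> obj -> SmallType;
  idm : forall X, hom X X;
  compose : forall X Y Z, hom Y Z -> hom X Y -> hom X Z;
  compose_idl : forall X Y (f : hom X Y), compose (idm Y) f = f;
  compose_idr : forall X Y (f : hom X Y), compose f (idm X) = f;
  composeA : forall X Y Z W (h : hom Z W) (g : hom Y Z) (f : hom X Y),
    compose h (compose g f) = compose (compose h g) f
}.

Arguments hom {c} X Y.
Arguments idm {c} X.
Arguments compose {c X Y Z} g f : rename.

Declare Scope cat_scope.
Delimit Scope cat_scope with cat.
Notation "g '\oc' f" := (compose g f)
  (at level 50, left associativity, format "g  '\oc'  f") : cat_scope.
Local Open Scope cat_scope.

Record functor (C D : category) := Functor {
  fobj :> C -> D;
  fmap : forall X Y, hom X Y -> hom (fobj X) (fobj Y);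
  fmap_id : forall X, fmap (idm X) = idm (fobj X);
  fmap_compose : forall X Y Z (g : hom Y Z) (f : hom X Y),
    fmap (g \oc f) = fmap g \oc fmap f
}.

Arguments fmap {C D} F {X Y} f : rename.

Definition functor_compose (C D E : category) (G : functor D E)
  (F : functor C D) : functor C E.
Proof.
exists (fun X => G (F X)) (fun X Y f => fmap G (fmap F f)).
- by move=> X; rewrite !fmap_id.
- by move=> X Y Z g f; rewrite !fmap_compose.
Defined.

Definition SET : category :=
  @Category SmallType (fun X Y => X -> Y) (fun X x => x)
    (fun X Y Z g f x => g (f x))
    (fun _ _ _ => erefl) (fun _ _ _ => erefl) (fun _ _ _ _ _ _ _ => erefl).

Definition hom_functor (C : category) (S : C) : functor C SET.
Proof.
exists ((fun X => hom S X) : C -> SET) (fun X Y (f : hom X Y) g => f \oc g).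
- by move=> X; apply: funext => g; exact: compose_idl.
- by move=> X Y Z g f; apply: funext => h; rewrite /= composeA.
Defined.

Record arrow (C : category) := Arrow {
  asrc : C;
  atgt : C;
  amor : hom asrc atgt
}.

Record square (C : category) (f g : arrow C) := Square {
  sqsrc : hom (asrc f) (asrc g);
  sqtgt : hom (atgt f) (atgt g);
  sq_comm : sqtgt \oc amor f = amor g \oc sqsrc
}.

Lemma square_eq (C : category) (f g : arrow C) (u v : square f g) :
  sqsrc u = sqsrc v -> sqtgt u = sqtgt v -> u = v.
Proof.
case: u v => [a b p] [a' b' q] /= ea eb.
by move: p q; rewrite ea eb => p q; congr Square; exact: Prop_irrelevance.
Qed.

Definition square_id (C : category) (f : arrow C) : square f f.
Proof.
by exists (idm _) (idm _); rewrite compose_idl compose_idr.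
Defined.

Definition square_compose (C : category) (f g h : arrow C)
  (v : square g h) (u : square f g) : square f h.
Proof.
exists (sqsrc v \oc sqsrc u) (sqtgt v \oc sqtgt u).
by rewrite -composeA sq_comm composeA sq_comm composeA.
Defined.

Definition arrow_category (C : category) : category.
Proof.
exists (arrow C) (@square C) (@square_id C) (@square_compose C).
- by move=> X Y f; apply: square_eq; rewrite /= compose_idl.
- by move=> X Y f; apply: square_eq; rewrite /= compose_idr.
- by move=> X Y Z W h g f; apply: square_eq; rewrite /= composeA.
Defined.

Record cocone (J C : category) (D : functor J C) (X : C) := Cocone {
  leg : forall j, hom (D j) X;
  leg_natural : forall (i j : J) (u : hom i j), leg j \oc fmap D u = leg i
}.

Arguments leg {J C D X} c j : rename.

Definition is_colimit (J C : category) (D : functor J C) (X : C)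
  (c : cocone D X) : Prop :=
  forall (Y : C) (d : cocone D Y),
    exists! h : hom X Y, forall j, h \oc leg c j = leg d j.

Definition cocone_map (J C E : category) (F : functor C E) (D : functor J C)
  (X : C) (c : cocone D X) : cocone (functor_compose F D) (F X).
Proof.
exists (fun j => fmap F (leg c j)).
by move=> i j u /=; rewrite -fmap_compose leg_natural.
Defined.

Record poset := Poset {
  pcar : SmallType;
  ple : pcar -> pcar -> Prop;
  ple_refl : forall x, ple x x;
  ple_trans : forall x y z, ple x y -> ple y z -> ple x z;
  ple_antisym : forall x y, ple x y -> ple y x -> x = y
}.

Coercion poset_carrier (P : poset) : Type := pcar P.

Definition poset_category (P : poset) : category.
Proof.
exists P (@ple P) (@ple_refl P) (fun x y z v u => ple_trans u v).
all: by move=> *; exact: Prop_irrelevance.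
Defined.

Definition directed (kappa : SmallType) (P : poset) : Prop :=
  forall S : set P, card_lt S [set: kappa] ->
    exists u : P, forall x, S x -> ple x u.

Definition has_directed_colimits (kappa : SmallType) (C : category) : Prop :=
  forall P : poset, directed kappa P ->
  forall D : functor (poset_category P) C,
    exists (X : C) (c : cocone D X), is_colimit c.

Definition preserves_directed_colimits (kappa : SmallType) (C E : category)
  (F : functor C E) : Prop :=
  forall P : poset, directed kappa P ->
  forall (D : functor (poset_category P) C) (X : C) (c : cocone D X),
    is_colimit c -> is_colimit (cocone_map F c).

Definition is_directed_colimit_of (kappa : SmallType) (C : category)
  (Q : C -> Prop) (X : C) : Prop :=
  exists P : poset, directed kappa P /\
  exists (D : functor (poset_category P) C) (c : cocone D X),
    is_colimit c /\ forall i, Q (D i).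

Definition presentable (kappa : SmallType) (C : category) (S : C) : Prop :=
  preserves_directed_colimits kappa (hom_functor S).

Definition accessible (kappa : SmallType) (C : category) : Prop :=
  has_directed_colimits kappa C /\
  exists (G : SmallType) (g : G -> C),
    (forall k, presentable kappa (g k)) /\
    (forall X : C, is_directed_colimit_of kappa (fun Y => exists k, Y = g k) X).

Definition is_product (C : category) (I : Type) (X : I -> C) (P : C)
  (p : forall i, hom P (X i)) : Prop :=
  forall (Y : C) (f : forall i, hom Y (X i)),
    exists! h : hom Y P, forall i, p i \oc h = f i.

Definition has_finite_products (C : category) : Prop :=
  forall (n : nat) (X : 'I_n -> C),
    exists (P : C) (p : forall i, hom P (X i)), is_product p.

Definition split_mono (C : category) (A B : C) (i : hom A B) : Prop :=
  exists s : hom B A, s \oc i = idm A.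

Definition pure_mono (kappa : SmallType) (A : category) (C D : A)
  (m : hom C D) : Prop :=
  forall S T : A, presentable kappa S -> presentable kappa T ->
  forall (t : hom S T) (c : hom S C) (d : hom T D),
    m \oc c = d \oc t -> exists e : hom T C, e \oc t = c.

Definition strongly_pure_mono (kappa : SmallType) (A : category) (C D : A)
  (m : hom C D) : Prop :=
  @is_directed_colimit_of kappa (arrow_category A)
    (fun f : arrow A => split_mono (amor f) /\
       presentable kappa (asrc f) /\ presentable kappa (atgt f))
    (Arrow m).

(* Main.v *)
From mathcomp Require Import all_boot.
From mathcomp Require Import boolp classical_sets functions cardinality.
Require Import Defs.

(** A strongly pure monomorphism is a directed colimit of split monomorphisms
    in the arrow category.  Since such colimits are computed at sources and at
    targets separately, a square from a map t of presentable objects factors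
    through one of these split monomorphisms, and its retraction yields the
    required diagonal.

    Conversely, let m : C -> D be pure.  The point is that every square from a
    map t : S -> T of presentable objects to m factors, over m, through a split
    monomorphism between generators ([split_dominates]).  Purity gives
    e : T -> C extending S -> C.  A generator X over C receives S and e
    compatibly, and a generator Y over D receives X and T compatibly; write
    m' : X -> Y for the resulting map.  Now (m', id) : X -> Y * X is split by
    the second projection, and t maps to it by S -> X and T -> Y * X, the
    second component of the latter coming from e.  The product Y * X need not
    be presentable, but it is a directed colimit of generators, and X and T are
    presentable, so everything factors through one generator B over Y * X.  The
    map X -> B is still split, by the second projection restricted to B.  This
    is where products are used.

    Every small diagram of squares over m from maps of presentable objects has a
    cocone of the same kind ([over_presentable_cone]).  Together with the
    previous paragraph this says that the split monomorphisms between
    generators over m form a kappa-filtered family, cofinal among all maps of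
    presentable objects over m.  A kappa-filtered family is replaced by a
    diagram on a kappa-directed poset with the same cofinality properties
    ([node_poset_directed], [node_functor_surj], [node_functor_cofinal]), and
    cofinality implies that its colimit is m: it suffices to test sources and
    targets against maps out of generators ([dense_colimit]). *)

Set Implicit Arguments.
Unset Strict Implicit.
Unset Printing Implicit Defensive.

Local Open Scope classical_set_scope.
Local Open Scope card_scope.
Local Open Scope cat_scope.

(** * Cardinals below a regular cardinal *)

(** A total relation with disjoint fibres contains an injection; comparability
    needs this in both directions of one and the same graph. *)
Lemma card_leT_rel (T U : Type) (R : T -> U -> Prop) :
  (forall x, exists y, R x y) -> (forall x x' y, R x y -> R x' y -> x = x') ->
  [set: T] #<= [set: U].
Proof.
move=> /choice[f Rf] Rinj.
have finj : {in [set: T] &, injective f}.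
  by move=> x x' _ _ e; apply: (Rinj _ _ (f x)); rewrite // e.
have := inj_card_eq finj; rewrite card_eq_le => /andP[_ le_f].
by apply: card_le_trans le_f _; exact: card_leT.
Qed.

(** Comparability of cardinals, by Zorn's lemma: a maximal partial injection
    from [T] to [U], encoded by its graph, is total or onto. *)
Lemma card_le_totalT (T U : Type) :
  [set: T] #<= [set: U] \/ [set: U] #<= [set: T].
Proof.
pose F (R : set (T * U)) := forall p q, R p -> R q -> p.1 = q.1 <-> p.2 = q.2.
have [G FG totG|R [FR Rmax]] := @Zorn_bigcup _ F.
  move=> p q [X GX Xp] [Y GY Yq].
  have [XY|YX] := totG _ _ GX GY.
  - by apply: (FG _ GY) => //; exact: XY.
  - by apply: (FG _ GX) => //; exact: YX.
have [domR|/existsNP[a aR]] := pselect (forall x, exists y, R (x, y)).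
  left; apply: (@card_leT_rel _ _ (fun x y => R (x, y))) => // x x' y Rx Rx'.
  exact: (FR _ _ Rx Rx').2.
have [imR|/existsNP[b bR]] := pselect (forall y, exists x, R (x, y)).
  right; apply: (@card_leT_rel _ _ (fun y x => R (x, y))) => // y y' x Ry Ry'.
  exact: (FR _ _ Ry Ry').1.
exfalso; apply: (Rmax (R `|` [set (a, b)])).
  split; first exact: subsetUl.
  by move=> /(_ (a, b) (or_intror erefl)) Rab; apply: aR; exists b.
move=> [x y] [x' y'] [Rp|/= [-> ->]] [Rq|/= [-> ->]] //=.
- exact: (FR _ _ Rp Rq).
- split=> e; exfalso; [apply: aR; exists y|apply: bR; exists x].
    by rewrite -e.
  by rewrite -e.
- split=> e; exfalso; [apply: aR; exists y'|apply: bR; exists x'].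
    by rewrite e.
  by rewrite e.
Qed.

Lemma card_le_total (T U : Type) (A : set T) (B : set U) :
  A #<= B \/ B #<= A.
Proof.
rewrite -(card_le_eql (card_setT A)) -(card_le_eqr (card_setT B)).
rewrite -[in X in _ \/ X](card_le_eql (card_setT B)).
rewrite -[in X in _ \/ X](card_le_eqr (card_setT A)).
exact: card_le_totalT.
Qed.

(** Thanks to comparability, smallness may be checked by refuting a single
    embedding. *)
Lemma card_ltNge (T U : Type) (A : set T) (B : set U) :
  ~ (B #<= A) -> card_lt A B.
Proof. by move=> nBA; split=> //; case: (card_le_total A B). Qed.

Lemma card_lt_le_trans (T U V : Type) (A : set T) (B : set U) (C : set V) :
  A #<= B -> card_lt B C -> card_lt A C.
Proof.
move=> AB [_ nCB]; apply: card_ltNge => CA.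
by apply: nCB; exact: card_le_trans CA AB.
Qed.

Lemma card_lt_setT (T U : Type) (A : set T) (B : set U) :
  card_lt A B -> card_lt [set: A] B.
Proof.
by apply: card_lt_le_trans; have := card_setT A; rewrite card_eq_le => /andP[].
Qed.

Lemma card_lt_image (T U V : Type) (f : T -> U) (A : set T) (B : set V) :
  card_lt A B -> card_lt (f @` A) B.
Proof. by apply: card_lt_le_trans; exact: card_image_le. Qed.

Lemma card_leT_inj (T U : Type) (B : set U) :
  [set: T] #<= B -> exists f : T -> U, injective f /\ forall x, B (f x).
Proof.
move=> /card_leP[f].
exists (fun x => \val (f (SigSub (mem_set (I : [set: T] x))))); split.
  by move=> x y /val_inj /(@inj _ _ _ f) -/(_ (mem_set I) (mem_set I)) [].
by move=> x; apply: set_mem; exact: valP.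
Qed.

Section Regular.
Variable kappa : SmallType.
Hypothesis kappa_regular : regular_cardinal kappa.

Lemma finite_small (T : Type) (A : set T) :
  finite_set A -> card_lt A [set: kappa].
Proof.
move=> finA; apply: card_ltNge => /card_le_finite/(_ finA).
by case: kappa_regular.
Qed.

(** Regularity is about unions of subsets of [kappa] that exhaust [kappa].
    An embedding of [kappa] into a union of small subsets of any type would pull
    the union back to such a family. *)
Lemma bigcup_small (I T : SmallType) (F : I -> set T) :
  card_lt [set: I] [set: kappa] -> (forall i, card_lt (F i) [set: kappa]) ->
  card_lt (\bigcup_i F i) [set: kappa].
Proof.
move=> smallI smallF; apply: card_ltNge.
move=> /card_leT_inj[f [finj fF]]; have [_ reg] := kappa_regular.
pose G i : set kappa := [set x | F i (f x)].
apply: (reg I G smallI) => [i|].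
- apply: card_lt_le_trans (smallF i).
  have : f @` G i #= G i by apply: inj_card_eq => x y _ _; exact: finj.
  rewrite card_eq_le => /andP[_ le_f]; apply: card_le_trans le_f _.
  by apply: subset_card_le => _ [x Gx <-].
- by apply/seteqP; split=> // x _; have [i _ Fi] := fF x; exists i.
Qed.

Lemma setU_small (T : SmallType) (A B : set T) :
  card_lt A [set: kappa] -> card_lt B [set: kappa] ->
  card_lt (A `|` B) [set: kappa].
Proof.
move=> sA sB; rewrite (_ : A `|` B = \bigcup_(b : bool) (if b then A else B)).
  apply: bigcup_small; last by case.
  exact/finite_small/finite_finset.
apply/seteqP; split=> [x [Ax|Bx]|x [[] _ ?]].
- by exists true.
- by exists false.
- by left.
- by right.
Qed.

Lemma sum_small (I K : SmallType) :
  card_lt [set: I] [set: kappa] -> card_lt [set: K] [set: kappa] ->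
  card_lt [set: I + K] [set: kappa].
Proof.
move=> sI sK.
have -> : [set: I + K] = range (@inl I K) `|` range (@inr I K).
  by apply/seteqP; split=> // -[i|k] _; [left; exists i|right; exists k].
by apply: setU_small => //; exact: card_lt_image.
Qed.

End Regular.

(** * Presentable objects and directed colimits *)

Section Directed.
Variable kappa : SmallType.
Hypothesis kappa_regular : regular_cardinal kappa.
Variable P : poset.
Hypothesis P_directed : directed kappa P.

Lemma directed_bound (I : SmallType) (f : I -> P) :
  card_lt [set: I] [set: kappa] -> exists u, forall i, ple (f i) u.
Proof.
move=> /(card_lt_image f) /P_directed[u uP]; exists u => i.
by apply: uP; exists i.
Qed.

Lemma directed_inhabited : exists u : P, True.
Proof.
have [|u _] := @directed_bound 'I_0 (fun i => False_rect _ (notF (ltn_ord i))).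
  exact/(finite_small kappa_regular)/finite_finset.
by exists u.
Qed.

Lemma directed_bound2 (p q : P) : exists2 u, ple p u & ple q u.
Proof.
have [|u uP] := @directed_bound bool (fun b => if b then p else q).
  exact/(finite_small kappa_regular)/finite_finset.
by exists u; [exact: (uP true)|exact: (uP false)].
Qed.

Variables (C : category) (D : functor (poset_category P) C).

Definition trans (p q : P) (pq : ple p q) : hom (D p) (D q) :=
  @fmap _ _ D p q pq.

Lemma trans_comp (p q r : P) (pq : ple p q) (qr : ple q r) (pr : ple p r) :
  trans qr \oc trans pq = trans pr.
Proof.
rewrite (Prop_irrelevance pr (ple_trans pq qr)).
exact: (esym (@fmap_compose _ _ D p q r qr pq)).
Qed.

Variables (X : C) (c : cocone D X).

Lemma leg_trans (p q : P) (pq : ple p q) : leg c q \oc trans pq = leg c p.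
Proof. exact: (@leg_natural _ _ _ _ c p q pq). Qed.

Hypothesis c_colimit : is_colimit c.
Variable S : C.
Hypothesis S_presentable : presentable kappa S.

Let hom_colimit : is_colimit (cocone_map (hom_functor S) c).
Proof. exact: S_presentable. Qed.

(** The two facts about maps from a presentable object to a directed colimit
    come from the universal property in the category of sets.  Here, two
    predicates on the colimit of the hom-sets, the constant one and membership
    in the union of the images, agree on every stage and hence coincide. *)
Lemma presentable_factor (f : hom S X) : exists p (g : hom S (D p)),
  leg c p \oc g = f.
Proof.
pose tt := @Cocone _ _ (functor_compose (hom_functor S) D) (Prop : SET)
  (fun _ _ => True) (fun _ _ _ => erefl).
have [h [_ huniq]] := hom_colimit tt.
have e1 := huniq (fun=> True) (fun=> erefl).
have e2 : h = (fun f => exists p (g : hom S (D p)), leg c p \oc g = f).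
  apply: huniq => p; apply: funext => g; apply: propext.
  by split=> // _; exists p, g.
by have := congr1 (@^~ f) e2; rewrite e1 => /= <-.
Qed.

(** An element [h] of stage [q] is sent to the set of elements of stage [p] to
    which it becomes equal later on.  This is a cocone, so it is constant on
    elements identified in the colimit; and [f] lies in its own image. *)
Lemma presentable_equalize (p : P) (f g : hom S (D p)) :
  leg c p \oc f = leg c p \oc g ->
  exists q (pq : ple p q), trans pq \oc f = trans pq \oc g.
Proof.
move=> fg.
pose d (q : P) := fun (h : hom S (D q)) (h' : hom S (D p)) =>
  exists r (qr : ple q r) (pr : ple p r), trans qr \oc h = trans pr \oc h'.
have dnat q r (qr : ple q r) h : d r (trans qr \oc h) = d q h.
  apply: funext => h'; apply: propext; split=> [[s [rs [ps e]]]|[s [qs [ps e]]]].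
    exists s, (ple_trans qr rs), ps.
    by rewrite -e composeA (trans_comp qr rs (ple_trans qr rs)).
  have [u ru su] := directed_bound2 r s.
  exists u, ru, (ple_trans ps su).
  rewrite composeA (trans_comp qr ru (ple_trans qs su)).
  by rewrite -(trans_comp ps su) -(trans_comp qs su) -!composeA e.
pose dd := @Cocone _ _ (functor_compose (hom_functor S) D)
  ((hom S (D p) -> Prop) : SET) d (fun q r qr => funext (dnat q r qr)).
have [h [hP _]] := hom_colimit dd.
have hd k : h (leg c p \oc k) = d p k by rewrite -[d p]hP.
have : d p f f by exists p, (ple_refl p), (ple_refl p).
rewrite -hd fg hd => -[q [pq [pq' e]]].
by exists q, pq; rewrite e (Prop_irrelevance pq' pq).
Qed.

End Directed.

Section Cones.
Variable kappa : SmallType.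
Hypothesis kappa_regular : regular_cardinal kappa.
Variables (P : poset) (C : category).
Hypothesis P_directed : directed kappa P.
Variables (D : functor (poset_category P) C) (X : C) (c : cocone D X).
Hypothesis c_colimit : is_colimit c.

(** A small diagram of presentable objects over a directed colimit factors
    through a single stage: the factorizations of the objects and the
    equalities imposed by the arrows are fewer than [kappa] requirements, each
    met from some stage on. *)
Lemma presentable_cone (I N : SmallType) (T : I -> C) (f : forall i, hom (T i) X)
    (s t : N -> I) (a : forall n, hom (T (s n)) (T (t n))) :
  card_lt [set: I] [set: kappa] -> card_lt [set: N] [set: kappa] ->
  (forall i, presentable kappa (T i)) ->
  (forall n, f (t n) \oc a n = f (s n)) ->
  exists p (g : forall i, hom (T i) (D p)),
    (forall i, leg c p \oc g i = f i) /\
    forall n, g (t n) \oc a n = g (s n).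
Proof.
move=> smallI smallN presT fa.
have fac i : {p & {g : hom (T i) (D p) | leg c p \oc g = f i}}.
  have /cid[p /cid[g gP]] := presentable_factor P_directed c_colimit (presT i) (f i).
  by exists p, g.
have [p pP] := directed_bound P_directed (fun i => tag (fac i)) smallI.
pose g i := trans D (pP i) \oc sval (tagged (fac i)).
have gP i : leg c p \oc g i = f i.
  by rewrite composeA leg_trans (svalP (tagged (fac i))).
have equ n : {q | exists pq : ple p q,
    trans D pq \oc (g (t n) \oc a n) = trans D pq \oc g (s n)}.
  apply/cid/(presentable_equalize kappa_regular P_directed c_colimit (presT _)).
  by rewrite composeA !gP fa.
have [q qP] := directed_bound P_directed (fun n => sval (equ n)) smallN.
have [r pr qr] := directed_bound2 kappa_regular P_directed p q.
exists r, (fun i => trans D pr \oc g i); split=> [i|n].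
  by rewrite composeA leg_trans gP.
have [pq e] := svalP (equ n).
have qnr := ple_trans (qP n) qr.
by rewrite -(trans_comp D pq qnr) -!composeA e.
Qed.

Lemma presentable_span (S A B : C) (a : hom S A) (b : hom S B)
    (f : hom A X) (g : hom B X) :
  presentable kappa S -> presentable kappa A -> presentable kappa B ->
  f \oc a = g \oc b ->
  exists p (f' : hom A (D p)) (g' : hom B (D p)),
    [/\ leg c p \oc f' = f, leg c p \oc g' = g & f' \oc a = g' \oc b].
Proof.
move=> presS presA presB fg.
have [p [f1 f1P]] := presentable_factor P_directed c_colimit presA f.
have [q [g1 g1P]] := presentable_factor P_directed c_colimit presB g.
have [r pr qr] := directed_bound2 kappa_regular P_directed p q.
have eq_p : leg c r \oc (trans D pr \oc f1 \oc a) =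
            leg c r \oc (trans D qr \oc g1 \oc b).
  by rewrite !composeA !leg_trans f1P g1P.
have [u [ru e]] := presentable_equalize kappa_regular P_directed c_colimit presS eq_p.
exists u, (trans D ru \oc (trans D pr \oc f1)), (trans D ru \oc (trans D qr \oc g1)).
split; last by rewrite -composeA e !composeA.
- by rewrite !composeA !leg_trans.
- by rewrite !composeA !leg_trans.
Qed.

Lemma presentable_factor_equalize (S T : C) (a b : hom S T) (f : hom T X) :
  presentable kappa S -> presentable kappa T -> f \oc a = f \oc b ->
  exists p (g : hom T (D p)), leg c p \oc g = f /\ g \oc a = g \oc b.
Proof.
move=> presS presT fab.
have [p [g gP]] := presentable_factor P_directed c_colimit presT f.
have eq_p : leg c p \oc (g \oc a) = leg c p \oc (g \oc b).
  by rewrite !composeA gP.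
have [q [pq e]] := presentable_equalize kappa_regular P_directed c_colimit presS eq_p.
exists q, (trans D pq \oc g); split; last by rewrite -!composeA.
by rewrite composeA leg_trans.
Qed.

End Cones.

Section Density.
Variable kappa : SmallType.
Hypothesis kappa_regular : regular_cardinal kappa.
Variables (C : category) (Q : C -> Prop) (X : C).
Hypothesis Q_presentable : forall Y, Q Y -> presentable kappa Y.
Hypothesis X_colimit : is_directed_colimit_of kappa Q X.
Variables (P : poset) (D : functor (poset_category P) C) (c : cocone D X).
Hypothesis P_directed : directed kappa P.
Hypothesis D_Q : forall x, Q (D x).

(** A cocone is a colimit as soon as its legs are jointly surjective, and its
    identifications happen at some stage, as seen by maps from the generating
    class [Q].  A competing cocone [d] defines a compatible family of maps on
    the objects of a presentation of [X] by [Q]; it is compatible because two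
    lifts of the same map have equal images under [d] ([legE]). *)
Lemma dense_colimit :
  (forall Y (a : hom Y X), Q Y ->
     exists x (b : hom Y (D x)), leg c x \oc b = a) ->
  (forall Y x (a b : hom Y (D x)), Q Y -> leg c x \oc a = leg c x \oc b ->
     exists y (xy : ple x y), trans D xy \oc a = trans D xy \oc b) ->
  is_colimit c.
Proof.
move=> surj inj Y d.
have legE V x y (a : hom V (D x)) (b : hom V (D y)) : Q V ->
    leg c x \oc a = leg c y \oc b -> leg d x \oc a = leg d y \oc b.
  move=> QV ab; have [z xz yz] := directed_bound2 kappa_regular P_directed x y.
  have [|u [zu e]] := inj V z (trans D xz \oc a) (trans D yz \oc b) QV.
    by rewrite !composeA !leg_trans.
  rewrite -(leg_trans d xz) -(leg_trans d yz) -(leg_trans d zu).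
  by rewrite -!composeA e.
have [P' [P'_directed [D' [c' [c'_colimit D'_Q]]]]] := X_colimit.
have lift p : {x & {b : hom (D' p) (D x) | leg c x \oc b = leg c' p}}.
  have /cid[x /cid[b bP]] := surj _ (leg c' p) (D'_Q p).
  by exists x, b.
pose x p := tag (lift p); pose b p := sval (tagged (lift p)).
have bP p : leg c (x p) \oc b p = leg c' p by exact: svalP (tagged (lift p)).
pose e := @Cocone _ _ D' Y (fun p => leg d (x p) \oc b p).
have e_nat p q (pq : @hom (poset_category P') p q) :
    leg d (x q) \oc b q \oc fmap D' pq = leg d (x p) \oc b p.
  by rewrite -composeA; apply: legE => //; rewrite composeA !bP leg_natural.
have [h [hP h_uniq]] := c'_colimit _ (e e_nat).
exists h; split=> [y|h' h'P].
  have [p [r rP]] := presentable_factor P'_directed c'_colimit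
    (Q_presentable (D_Q y)) (leg c y).
  rewrite -rP composeA hP /= -composeA -[RHS]compose_idr; apply: legE => //.
  by rewrite composeA bP rP compose_idr.
by apply: h_uniq => p; rewrite -bP composeA h'P.
Qed.

End Density.

(** * Colimits in arrow categories and slices *)

Lemma colimit_retract (J C : category) (D : functor J C) (X Y : C)
    (c : cocone D X) (d : cocone D Y) :
  is_colimit c -> is_colimit d ->
  exists (f : hom X Y) (g : hom Y X), g \oc f = idm X.
Proof.
move=> c_colimit d_colimit.
have [f [fP _]] := c_colimit _ d; have [g [gP _]] := d_colimit _ c.
exists f, g; have [h [_ h_uniq]] := c_colimit _ c.
rewrite -[LHS]h_uniq => [|j]; last by rewrite -composeA fP gP.
by apply: h_uniq => j; rewrite compose_idl.
Qed.

Definition src_functor (C : category) : functor (arrow_category C) C :=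
  @Functor (arrow_category C) C (@asrc C) (fun f g u => sqsrc u)
    (fun _ => erefl) (fun _ _ _ _ _ => erefl).

Definition tgt_functor (C : category) : functor (arrow_category C) C :=
  @Functor (arrow_category C) C (@atgt C) (fun f g u => sqtgt u)
    (fun _ => erefl) (fun _ _ _ _ _ => erefl).

Section ArrowColimit.
Variables (C J : category) (D : functor J (arrow_category C)).

(** Only the commutation of the induced square has to be checked, and it follows
    from uniqueness for the source colimit. *)
Lemma arrow_colimit (X : arrow_category C) (c : cocone D X) :
  is_colimit (cocone_map (src_functor C) c) ->
  is_colimit (cocone_map (tgt_functor C) c) -> is_colimit c.
Proof.
move=> c_src c_tgt Y d.
have [h [hP h_uniq]] := c_src _ (cocone_map (src_functor C) d).
have [k [kP k_uniq]] := c_tgt _ (cocone_map (tgt_functor C) d).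
have e_nat i j (u : @hom J i j) :
    amor Y \oc sqsrc (leg d j) \oc
      fmap (functor_compose (src_functor C) D) u = amor Y \oc sqsrc (leg d i).
  by rewrite -composeA (leg_natural (cocone_map (src_functor C) d) u).
have [l [lP l_uniq]] := c_src _ (@Cocone _ _ (functor_compose (src_functor C) D)
  (atgt Y) (fun j => amor Y \oc sqsrc (leg d j)) e_nat).
have hk : k \oc amor X = amor Y \oc h.
  transitivity l; [apply: esym|]; apply: l_uniq => j /=.
    rewrite -composeA -sq_comm composeA.
    have /= -> := kP j; exact: sq_comm.
  by rewrite -composeA; have /= -> := hP j.
exists (Square hk); split=> [j|v vP].
  by apply: square_eq; [exact: (hP j)|exact: (kP j)].
apply: square_eq; [apply: h_uniq|apply: k_uniq] => j /=.
- by rewrite -vP.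
- by rewrite -vP.
Qed.

(** The converse of [arrow_colimit] for a given colimit is obtained from this
    one by comparing the two with [colimit_retract]. *)
Lemma arrow_colimit_exists :
  (exists S (s : cocone (functor_compose (src_functor C) D) S), is_colimit s) ->
  (exists T (t : cocone (functor_compose (tgt_functor C) D) T), is_colimit t) ->
  exists (X : arrow_category C) (c : cocone D X),
    is_colimit (cocone_map (src_functor C) c) /\
    is_colimit (cocone_map (tgt_functor C) c).
Proof.
move=> [S [s s_colimit]] [T [t t_colimit]].
have e_nat i j (u : @hom J i j) :
    leg t j \oc amor (D j) \oc fmap (functor_compose (src_functor C) D) u =
    leg t i \oc amor (D i).
  by rewrite -composeA /= -sq_comm composeA (leg_natural t u).
have [x [xP _]] := s_colimit _ (@Cocone _ _ (functor_compose (src_functor C) D)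
  T (fun j => leg t j \oc amor (D j)) e_nat).
pose lg j : @hom (arrow_category C) (D j) (Arrow x) :=
  @Square _ (D j) (Arrow x) (leg s j) (leg t j) (esym (xP j)).
have lg_nat i j (u : @hom J i j) : lg j \oc fmap D u = lg i.
  by apply: square_eq; [exact: (leg_natural s u)|exact: (leg_natural t u)].
exists (Arrow x), (Cocone lg_nat).
by split=> Y d; [apply: s_colimit|apply: t_colimit].
Qed.

End ArrowColimit.

Record over_obj (C : category) (X : C) := Over {
  over_dom : C;
  over_map : hom over_dom X
}.

Record over_hom (C : category) (X : C) (a b : over_obj X) := OverHom {
  over_val : hom (over_dom a) (over_dom b);
  over_comm : over_map b \oc over_val = over_map a
}.

Lemma over_hom_eq (C : category) (X : C) (a b : over_obj X)
  (f g : over_hom a b) : over_val f = over_val g -> f = g.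
Proof.
case: f g => [f p] [g q] /= fg; move: p q; rewrite fg => p q.
by congr OverHom; exact: Prop_irrelevance.
Qed.

Definition over_compose (C : category) (X : C) (a b d : over_obj X)
  (g : over_hom b d) (f : over_hom a b) : over_hom a d.
Proof.
by exists (over_val g \oc over_val f); rewrite composeA !over_comm.
Defined.

Definition over_category (C : category) (X : C) : category.
Proof.
exists (over_obj X) (@over_hom C X)
  (fun a => OverHom (compose_idr (over_map a))) (@over_compose C X).
- by move=> a b f; apply: over_hom_eq; rewrite /= compose_idl.
- by move=> a b f; apply: over_hom_eq; rewrite /= compose_idr.
- by move=> a b d e h g f; apply: over_hom_eq; rewrite /= composeA.
Defined.

Definition over_forget (C : category) (X : C) : functor (over_category X) C :=
  @Functor (over_category X) C (@over_dom C X) (fun a b f => over_val f)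
    (fun _ => erefl) (fun _ _ _ _ _ => erefl).

Definition over_cocone (C : category) (X : C) (J : category)
  (U : functor J (over_category X)) :
  cocone (functor_compose (over_forget X) U) X.
Proof.
by exists (fun j => over_map (U j)) => i j u; exact: over_comm.
Defined.

(** * From a filtered family to a directed poset *)

(** [ob] enumerates a small full subcategory; a diagram is a graph with vertices
    [I] and arrows [N], which need not be closed under composition. *)
Definition filtered (kappa : SmallType) (J : category) (O : SmallType)
    (ob : O -> J) : Prop :=
  forall (I N : SmallType) (t : I -> O) (s e : N -> I)
    (a : forall n, hom (ob (t (s n))) (ob (t (e n)))),
    card_lt [set: I] [set: kappa] -> card_lt [set: N] [set: kappa] ->
    exists (w : O) (f : forall i, hom (ob (t i)) (ob w)),
      forall n, f (e n) \oc a n = f (s n).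

Section DirectedReplacement.
Variable kappa : SmallType.
Hypothesis kappa_regular : regular_cardinal kappa.
Variables (J : category) (O : SmallType) (ob : O -> J).
Hypothesis ob_filtered : filtered kappa ob.

(** Each object is given [kappa] many copies, so that a small set of arrows
    always misses a copy of any given object. *)
Let vertex : SmallType := (O * kappa)%type.
Let vob (x : vertex) : J := ob x.1.

Record edge := Edge {
  esrc : vertex;
  etgt : vertex;
  emor : hom (vob esrc) (vob etgt)
}.

(** Edges with prescribed ends are compared by transporting along equality
    proofs, which are unique. *)
Lemma edge_inj (x y : vertex) (f g : hom (vob x) (vob y)) :
  Edge f = Edge g -> f = g.
Proof.
pose cast (a : edge) (ex : esrc a = x) (ey : etgt a = y) :=
  ecast z (hom (vob z) (vob y)) ex (ecast z (hom _ (vob z)) ey (emor a)).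
have castE a b ex ey ex' ey' : a = b -> cast a ex ey = cast b ex' ey'.
  by move=> ab; move: ex ey; rewrite ab => ex ey;
     rewrite (Prop_irrelevance ex ex') (Prop_irrelevance ey ey').
exact: (castE (Edge f) (Edge g) erefl erefl erefl erefl).
Qed.

Definition ends (M : set edge) : set vertex := esrc @` M `|` etgt @` M.

Lemma esrc_ends (M : set edge) (a : edge) : M a -> ends M (esrc a).
Proof. by move=> Ma; left; exists a. Qed.

Lemma etgt_ends (M : set edge) (a : edge) : M a -> ends M (etgt a).
Proof. by move=> Ma; right; exists a. Qed.

Definition src_end (M : set edge) (a : edge) (Ma : M a) : ends M :=
  SigSub (mem_set (esrc_ends Ma)).

Definition tgt_end (M : set edge) (a : edge) (Ma : M a) : ends M :=
  SigSub (mem_set (etgt_ends Ma)).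

(** A small set of arrows together with a vertex that is terminal for it: each
    vertex of the set has exactly one arrow to [ntop] in the set, and these
    arrows form a cocone. *)
Record node := Node {
  nset : set edge;
  ntop : vertex;
  nset_small : card_lt nset [set: kappa];
  nset_top : nset (Edge (idm (vob ntop)));
  nset_leg : forall a, nset a ->
    exists h : hom (vob (etgt a)) (vob ntop), nset (Edge h);
  nset_comp : forall a (h : hom (vob (etgt a)) (vob ntop)),
    nset a -> nset (Edge h) -> nset (Edge (h \oc emor a));
  nset_uniq : forall x (h h' : hom (vob x) (vob ntop)),
    nset (Edge h) -> nset (Edge h') -> h = h'
}.

Lemma ends_leg (x : node) v : ends (nset x) v ->
  exists h : hom (vob v) (vob (ntop x)), nset x (Edge h).
Proof.
move=> [[a xa <-]|[a xa <-]]; have [h xh] := nset_leg xa; last by exists h.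
by exists (h \oc emor a); exact: nset_comp.
Qed.

(** Asking in the strict case that the top of the larger node be a new vertex is
    what makes the relation antisymmetric, since distinct tops may be
    isomorphic. *)
Definition node_le (x y : node) :=
  x = y \/ nset x `<=` nset y /\ ~ nset x (Edge (idm (vob (ntop y)))).

Lemma node_le_sub x y : node_le x y -> nset x `<=` nset y.
Proof. by move=> [->|[]]. Qed.

Lemma node_le_refl x : node_le x x. Proof. by left. Qed.

Lemma node_le_trans x y z : node_le x y -> node_le y z -> node_le x z.
Proof.
move=> [->//|[xy xNy]] [<-|[yz yNz]]; right; split=> //.
- exact: subset_trans xy yz.
- by move=> /xy.
Qed.

Lemma node_le_antisym x y : node_le x y -> node_le y x -> x = y.
Proof.
move=> [//|[xy xNy]] yx; exfalso; apply: xNy.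
exact: (node_le_sub yx (nset_top y)).
Qed.

Definition node_poset : poset :=
  Poset node_le_refl node_le_trans node_le_antisym.

Lemma node_trans_ex x y : node_le x y ->
  {h : hom (vob (ntop x)) (vob (ntop y)) | nset y (Edge h)}.
Proof.
by move=> /node_le_sub xy; apply/cid/(nset_leg (xy _ (nset_top x))).
Qed.

Definition node_trans x y (xy : node_le x y) := sval (node_trans_ex xy).

Lemma node_transE x y (xy : node_le x y) (h : hom (vob (ntop x)) (vob (ntop y))) :
  nset y (Edge h) -> node_trans xy = h.
Proof. exact/nset_uniq/(svalP (node_trans_ex xy)). Qed.

(** The transition from [x] to [y] is the unique arrow of [y] between the two
    tops; uniqueness makes this functorial. *)
Definition node_functor : functor (poset_category node_poset) J.
Proof.
exists (fun x : poset_category node_poset => vob (ntop x)) node_trans.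
- by move=> x; apply: node_transE; exact: nset_top.
- move=> x y z yz xy; apply: node_transE.
  apply: (@nset_comp z (Edge (node_trans xy))); last first.
    exact: (svalP (node_trans_ex yz)).
  exact: (node_le_sub yz (svalP (node_trans_ex xy))).
Defined.

Lemma ends_small (M : set edge) :
  card_lt M [set: kappa] -> card_lt (ends M) [set: kappa].
Proof. by move=> sM; apply: setU_small => //; exact: card_lt_image. Qed.

Lemma fresh_label (M : set edge) : card_lt M [set: kappa] ->
  exists l, forall o, ~ ends M (o, l).
Proof.
move=> /ends_small /(card_lt_image snd) [_ nle].
have [l lM] : exists l, ~ (snd @` ends M) l.
  by apply/existsNP => lM; apply: nle; apply: subset_card_le => l _; exact: lM.
by exists l => o oM; apply: lM; exists (o, l).
Qed.

Section Extension.
Variables (M : set edge) (w : O).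
Variable f : forall i : ends M, hom (vob (\val i)) (ob w).
Hypothesis M_small : card_lt M [set: kappa].
Hypothesis f_nat : forall a (Ma : M a),
  f (tgt_end Ma) \oc emor a = f (src_end Ma).
Variable l : kappa.
Let top : vertex := (w, l).
Hypothesis top_fresh : ~ ends M top.

(** The arrows of [M], together with a cocone on them whose vertex [top] is
    fresh. *)
Inductive cone_set : set edge :=
| cone_old a of M a : cone_set a
| cone_top : cone_set (@Edge top top (idm (vob top)))
| cone_leg i : cone_set (@Edge (\val i) top (f i)).

Lemma cone_set_small : card_lt cone_set [set: kappa].
Proof.
apply: card_lt_le_trans (_ : card_lt (M `|`
  ([set @Edge top top (idm (vob top))] `|`
   range (fun i : ends M => @Edge (\val i) top (f i)))) _).
  apply: subset_card_le => _ [a Ma||i]; [by left|by right; left|].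
  by right; right; exists i.
apply: setU_small => //; apply: setU_small => //.
  exact: (finite_small kappa_regular).
apply: card_lt_image; apply: card_lt_setT; exact: ends_small.
Qed.

Lemma cone_set_into_top a : cone_set a -> etgt a = top ->
  a = @Edge top top (idm (vob top)) \/ exists i, a = @Edge (\val i) top (f i).
Proof.
move=> [{}a Ma atop||i]; [|by left|by right; exists i].
by exfalso; apply: top_fresh; rewrite -atop; exact: etgt_ends.
Qed.

Lemma cone_set_uniq x (h h' : hom (vob x) (vob top)) :
  cone_set (Edge h) -> cone_set (Edge h') -> h = h'.
Proof.
have vM (i : ends M) : \val i <> top.
  by move=> e; apply: top_fresh; rewrite -e; apply: set_mem; exact: valP.
move=> /cone_set_into_top/(_ erefl) [e|[i e]]
  /cone_set_into_top/(_ erefl) [e'|[j e']].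
- by apply: edge_inj; rewrite e e'.
- by case: (vM j); have /= <- := congr1 esrc e'; have /= <- := congr1 esrc e.
- by case: (vM i); have /= <- := congr1 esrc e'; have /= <- := congr1 esrc e.
- apply: edge_inj; rewrite e e'; suff -> : i = j by [].
  by apply: val_inj; have /= <- := congr1 esrc e'; have /= <- := congr1 esrc e.
Qed.

Lemma cone_set_leg a : cone_set a ->
  exists h : hom (vob (etgt a)) (vob top), cone_set (Edge h).
Proof.
move=> [{}a Ma||i].
- by exists (f (tgt_end Ma)); exact: (cone_leg (tgt_end Ma)).
- by exists (idm (vob top)); exact: cone_top.
- by exists (idm (vob top)); exact: cone_top.
Qed.

Lemma cone_set_comp a (h : hom (vob (etgt a)) (vob top)) :
  cone_set a -> cone_set (Edge h) -> cone_set (Edge (h \oc emor a)).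
Proof.
move=> ca; case: ca h => [{}a Ma||i] h ch /=.
- rewrite (cone_set_uniq ch (cone_leg (tgt_end Ma))) f_nat.
  exact: (cone_leg (src_end Ma)).
- by rewrite compose_idr.
- by rewrite (cone_set_uniq ch cone_top) compose_idl; exact: cone_leg.
Qed.

Definition cone_node : node :=
  Node cone_set_small cone_top cone_set_leg cone_set_comp cone_set_uniq.

End Extension.

(** Every cocone on a small set of arrows is realized by a node above that set.
    The map [r] identifies the vertex of the cocone with its fresh copy. *)
Lemma node_extension (M : set edge) (w : O)
    (f : forall i : ends M, hom (vob (\val i)) (ob w)) :
  card_lt M [set: kappa] ->
  (forall a (Ma : M a), f (tgt_end Ma) \oc emor a = f (src_end Ma)) ->
  exists y : node, [/\ M `<=` nset y,
    ~ M (Edge (idm (vob (ntop y)))) &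
    exists r : hom (ob w) (vob (ntop y)),
      forall i : ends M, nset y (Edge (r \oc f i))].
Proof.
move=> M_small f_nat; have [l lP] := fresh_label M_small.
exists (cone_node M_small f_nat (lP w)); split=> /=.
- by move=> a Ma; exact: cone_old.
- by move=> /esrc_ends; exact: lP.
- by exists (idm (ob w)) => i; rewrite compose_idl; exact: cone_leg.
Qed.

(** The union of a small set of nodes is small, so it has a cocone by
    filteredness, and the extension of the union by this cocone is an upper
    bound. *)
Lemma node_poset_directed : directed kappa node_poset.
Proof.
move=> S S_small; pose M := \bigcup_(x : S) nset (\val x).
have M_small : card_lt M [set: kappa].
  apply: bigcup_small => // [|x]; [exact: card_lt_setT|exact: nset_small].
have [||w [f fP]] := @ob_filtered (ends M) M (fun i => (\val i).1)
  (fun a => src_end (set_mem (valP a))) (fun a => tgt_end (set_mem (valP a)))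
  (fun a => emor (\val a)).
- exact/card_lt_setT/ends_small.
- exact: card_lt_setT.
have [|y [My yM _]] := @node_extension M w f M_small.
  move=> a Ma; have := fP (SigSub (mem_set Ma)).
  by rewrite (Prop_irrelevance (set_mem _) Ma).
exists y => x Sx; right.
have xM : nset x `<=` M by move=> a xa; exists (SigSub (mem_set Sx)).
by split; [exact: subset_trans xM My|move=> /xM].
Qed.

Lemma node_functor_surj (o : O) : exists x : node_poset,
  exists r : hom (ob o) (node_functor x), True.
Proof.
have f (i : ends set0) : hom (vob (\val i)) (ob o).
  by exfalso; have [[a []]|[a []]] := set_mem (valP i).
have [||y [_ _ [r _]]] := @node_extension set0 o f.
- exact: (finite_small kappa_regular).
- by [].
by exists y, r.
Qed.

(** Composing the arrows of [x] into its top with [s] gives a cocone on [x]. *)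
Lemma node_functor_cofinal (x : node_poset) (o : O)
    (s : hom (node_functor x) (ob o)) :
  exists y (xy : ple x y) (r : hom (ob o) (node_functor y)),
    trans node_functor xy = r \oc s.
Proof.
have leg_ex (i : ends (nset x)) :
    {h : hom (vob (\val i)) (vob (ntop x)) | nset x (Edge h)}.
  by apply/cid/ends_leg/set_mem; exact: valP.
have [||y [xy yNx [r rP]]] :=
  @node_extension (nset x) o (fun i => s \oc sval (leg_ex i)).
- exact: nset_small.
- move=> a xa; rewrite -composeA; congr (s \oc _).
  apply: nset_uniq; last exact: svalP (leg_ex (src_end xa)).
  exact: (nset_comp xa (svalP (leg_ex (tgt_end xa)))).
have le_xy : node_le x y by right.
exists y, le_xy, r; apply: (node_transE le_xy).
have := rP (src_end (nset_top x)).
have /= -> := nset_uniq (svalP (leg_ex (src_end (nset_top x)))) (nset_top x).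
by rewrite compose_idr.
Qed.

End DirectedReplacement.

(** * Squares over a pure monomorphism *)

(** Indexing by ['I_2] makes the factors a dependent family; the case analysis on
    [i == ord0] types both components. *)
Lemma has_binary_products (C : category) (X Y : C) : has_finite_products C ->
  exists (Z : C) (p : hom Z X) (q : hom Z Y),
    forall W (f : hom W X) (g : hom W Y),
      exists! h : hom W Z, p \oc h = f /\ q \oc h = g.
Proof.
move=> prodC; pose F (i : 'I_2) := if i == ord0 then X else Y.
have [Z [pr prP]] := prodC 2%N F.
exists Z, (pr ord0), (pr ord_max) => W f g.
pose fg (i : 'I_2) : hom W (F i) :=
  match i == ord0 as b return hom W (if b then X else Y) with
  | true => f | false => g end.
have [h [hP h_uniq]] := prP W fg.
exists h; split=> [|k [kf kg]];
  first by split; [exact: (hP ord0)|exact: (hP ord_max)].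
apply: h_uniq => i; rewrite /fg.
case: (unliftP ord0 i) => [j|] ->; last exact: kf.
have -> : lift ord0 j = ord_max by apply: val_inj; rewrite /= (ord1 j).
exact: kg.
Qed.

Section OverArrow.
Variables (A : category) (C D : A) (m : hom C D).

(** An object is a square from some map to [m]. *)
Definition over_arrow : category := over_category (Arrow m : arrow_category A).

Implicit Types t u : over_arrow.

Definition osrc t : A := asrc (over_dom t).
Definition otgt t : A := atgt (over_dom t).
Definition omor t : hom (osrc t) (otgt t) := amor (over_dom t).
Definition osrc_map t : hom (osrc t) C := sqsrc (over_map t).
Definition otgt_map t : hom (otgt t) D := sqtgt (over_map t).

Lemma omor_comm t : otgt_map t \oc omor t = m \oc osrc_map t.
Proof. exact: sq_comm (over_map t). Qed.

Definition over_arrow_obj (S T : A) (f : hom S T) (c : hom S C) (d : hom T D)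
    (e : d \oc f = m \oc c) : over_arrow :=
  @Over (arrow_category A) (Arrow m) (Arrow f)
    (@Square A (Arrow f) (Arrow m) c d e).

Definition ohom_src t u (f : hom t u) : hom (osrc t) (osrc u) :=
  sqsrc (over_val f).
Definition ohom_tgt t u (f : hom t u) : hom (otgt t) (otgt u) :=
  sqtgt (over_val f).

Lemma ohom_srcE t u (f : hom t u) : osrc_map u \oc ohom_src f = osrc_map t.
Proof.
exact: (congr1 (fun v : square (over_dom t) (Arrow m) => sqsrc v) (over_comm f)).
Qed.

Lemma ohom_tgtE t u (f : hom t u) : otgt_map u \oc ohom_tgt f = otgt_map t.
Proof.
exact: (congr1 (fun v : square (over_dom t) (Arrow m) => sqtgt v) (over_comm f)).
Qed.

Lemma over_arrow_hom t u (a : hom (osrc t) (osrc u)) (b : hom (otgt t) (otgt u)) :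
  b \oc omor t = omor u \oc a ->
  osrc_map u \oc a = osrc_map t -> otgt_map u \oc b = otgt_map t ->
  {f : hom t u | ohom_src f = a /\ ohom_tgt f = b}.
Proof.
move=> e ea eb; pose v : square (over_dom t) (over_dom u) := Square e.
have vE : over_map u \oc (v : @hom (arrow_category A) _ _) = over_map t.
  exact: square_eq.
by exists (OverHom vE).
Qed.

Lemma over_arrow_ext t u (f g : hom t u) :
  ohom_src f = ohom_src g -> ohom_tgt f = ohom_tgt g -> f = g.
Proof. by move=> e1 e2; apply: over_hom_eq; exact: square_eq. Qed.

End OverArrow.

Section PureMono.
Variable kappa : SmallType.
Hypothesis kappa_regular : regular_cardinal kappa.
Variables (A : category) (Q : A -> Prop).
Hypothesis Q_presentable : forall Y, Q Y -> presentable kappa Y.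
Hypothesis Q_generates : forall Y : A, is_directed_colimit_of kappa Q Y.
Variables (C D : A) (m : hom C D).

Local Notation J := (over_arrow m).

(** First the sources are sent to one stage [X p] of a presentation of [C].  The
    targets, the sources and [X p] then form a single diagram over [D], whose
    arrows are those of the given diagram on targets, the maps from sources to
    targets, and the maps from sources to [X p].  A cocone of that diagram at
    one stage over [D] contains the map out of [X p] and all the squares. *)
Lemma over_presentable_cone (I N : SmallType) (t : I -> J) (s e : N -> I)
    (a : forall n, @hom J (t (s n)) (t (e n))) :
  card_lt [set: I] [set: kappa] -> card_lt [set: N] [set: kappa] ->
  (forall i, presentable kappa (osrc (t i)) /\ presentable kappa (otgt (t i))) ->
  exists w : J, [/\ Q (osrc w), Q (otgt w) &
    exists f : forall i, @hom J (t i) w, forall n, f (e n) \oc a n = f (s n)].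
Proof.
move=> sI sN pres.
have [P [P_dir [X [x [x_col XQ]]]]] := Q_generates C.
have [R [R_dir [Y [y [y_col YQ]]]]] := Q_generates D.
have [p [f [fP fN]]] := presentable_cone kappa_regular P_dir x_col
  (f := fun i => osrc_map (t i)) sI sN (fun i => (pres i).1) (fun n => ohom_srcE (a n)).
pose T (i : I + I + unit) : A := match i with
  | inl (inl i) => osrc (t i) | inl (inr i) => otgt (t i) | inr _ => X p end.
pose g (i : I + I + unit) : hom (T i) D := match i with
  | inl (inl i) => m \oc osrc_map (t i) | inl (inr i) => otgt_map (t i)
  | inr _ => m \oc leg x p end.
pose ss (n : N + I + I) : I + I + unit := match n with
  | inl (inl n) => inl (inr (s n)) | inl (inr i) => inl (inl i)
  | inr i => inl (inl i) end.
pose ee (n : N + I + I) : I + I + unit := match n with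
  | inl (inl n) => inl (inr (e n)) | inl (inr i) => inl (inr i)
  | inr i => inr tt end.
pose b (n : N + I + I) : hom (T (ss n)) (T (ee n)) := match n with
  | inl (inl n) => ohom_tgt (a n) | inl (inr i) => omor (t i)
  | inr i => f i end.
have [||||q [h [hP hN]]] := @presentable_cone _ kappa_regular _ _ R_dir _ _ _ y_col
  _ _ T g ss ee b.
- apply: sum_small => //; first exact: sum_small.
  exact/(finite_small kappa_regular)/finite_finset.
- by apply: sum_small => //; exact: sum_small.
- by move=> [[i|i]|[]] /=; [exact: (pres i).1|exact: (pres i).2|exact: Q_presentable].
- move=> [[n|i]|i] /=; [exact: ohom_tgtE|exact: omor_comm|].
  by rewrite -composeA fP.
have wE : leg y q \oc h (inr tt) = m \oc leg x p by exact: (hP (inr tt)).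
exists (over_arrow_obj wE); split; [exact: XQ|exact: YQ|].
have fE i : h (inl (inr i)) \oc omor (t i) = h (inr tt) \oc f i.
  by rewrite (hN (inl (inr i))) (hN (inr i)).
have k i := @over_arrow_hom _ _ _ m (t i) (over_arrow_obj wE) _ _ (fE i) (fP i)
  (hP (inl (inr i))).
exists (fun i => sval (k i)) => n.
have [ke1 ke2] := svalP (k (e n)); have [ks1 ks2] := svalP (k (s n)).
apply: over_arrow_ext.
- rewrite ks1 -fN; exact: (congr1 (fun g => g \oc ohom_src (a n)) ke1).
- rewrite ks2 -[RHS](hN (inl (inl n))).
  exact: (congr1 (fun g => g \oc ohom_tgt (a n)) ke2).
Qed.

Hypothesis A_products : has_finite_products A.
Hypothesis m_pure : pure_mono kappa m.

(** The construction [X -> B] over [Y * X] described at the top.  Purity enters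
    only through [e]. *)
Lemma split_dominates (t : J) :
  presentable kappa (osrc t) -> presentable kappa (otgt t) ->
  exists w : J, [/\ Q (osrc w), Q (otgt w), split_mono (omor w) &
    exists f : @hom J t w, True].
Proof.
move=> pS pT.
have [e eP] := m_pure pS pT (esym (omor_comm t)).
have [P [P_dir [X [x [x_col XQ]]]]] := Q_generates C.
have [p [e' [c' [eP' cP' ec]]]] := presentable_span kappa_regular P_dir x_col
  pS pT pS (etrans eP (esym (compose_idr (osrc_map t)))).
have pX := Q_presentable (XQ p).
have [R [R_dir [Y [y [y_col YQ]]]]] := Q_generates D.
have dc : otgt_map t \oc omor t = m \oc leg x p \oc c'.
  by rewrite -composeA cP' omor_comm.
have [q [d' [m' [dP' mP' dm]]]] := presentable_span kappa_regular R_dir y_col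
  pS pT pX dc.
have [Z [pr1 [pr2 Z_prod]]] := has_binary_products (Y q) (X p) A_products.
have [u [[u1 u2] _]] := Z_prod _ d' e'.
have [v [[v1 v2] _]] := Z_prod _ m' (idm (X p)).
(* Both sides have components d' t and e' t = c' in the product. *)
have uv : u \oc omor t = v \oc c'.
  have [h [_ h_uniq]] := Z_prod _ (d' \oc omor t) (e' \oc omor t).
  rewrite -[LHS]h_uniq; last by rewrite !composeA u1 u2.
  apply: h_uniq; rewrite !composeA v1 v2 dm ec !compose_idl compose_idr.
  done.
have [B [B_dir [Z' [z [z_col ZQ]]]]] := Q_generates Z.
have [l [u' [i [uP iP ui]]]] := presentable_span kappa_regular B_dir z_col
  pS pT pX uv.
have wE : leg y q \oc pr1 \oc leg z l \oc i = m \oc leg x p.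
  by rewrite -composeA iP -composeA v1.
have si : pr2 \oc leg z l \oc i = idm (X p) by rewrite -composeA iP.
exists (over_arrow_obj wE); split; [exact: XQ|exact: ZQ| |].
  by exists (pr2 \oc leg z l).
have fs : leg x p \oc c' = osrc_map t by [].
have ft : leg y q \oc pr1 \oc leg z l \oc u' = otgt_map t.
  by rewrite -composeA uP -composeA u1.
have [f _] := @over_arrow_hom _ _ _ m t (over_arrow_obj wE) c' u' ui fs ft.
by exists f.
Qed.

End PureMono.

(** * The two classes of monomorphisms *)

Section PureIsStronglyPure.
Variable kappa : SmallType.
Hypothesis kappa_regular : regular_cardinal kappa.
Variables (A : category) (G : SmallType) (g : G -> A).
Hypothesis g_presentable : forall k, presentable kappa (g k).
Let Q (Y : A) := exists k, Y = g k.
Hypothesis g_generates : forall Y : A, is_directed_colimit_of kappa Q Y.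
Hypothesis A_products : has_finite_products A.
Variables (C D : A) (m : hom C D).
Hypothesis m_pure : pure_mono kappa m.

Let Q_presentable Y : Q Y -> presentable kappa Y.
Proof. by move=> [k ->]. Qed.

Local Notation J := (over_arrow m).

(** Split monomorphisms between generators, with a square to [m].  Using indices
    of generators in place of objects keeps this type small, as the index
    poset of the colimit has to be. *)
Record gen_split := GenSplit {
  gsrc : G;
  gtgt : G;
  gmor : hom (g gsrc) (g gtgt);
  gsrc_map : hom (g gsrc) C;
  gtgt_map : hom (g gtgt) D;
  gcomm : gtgt_map \oc gmor = m \oc gsrc_map;
  gsplit : split_mono gmor
}.

Let ob (o : gen_split) : J := over_arrow_obj (gcomm o).

Let ob_onto (w : J) : Q (osrc w) -> Q (otgt w) -> split_mono (omor w) ->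
  exists o, ob o = w.
Proof.
case: w => -[S T f] [c d e]; rewrite /osrc /otgt /omor /= => -[k kE] [l lE].
by move: f c d e; rewrite kE lE => f c d e f_split; exists (GenSplit e f_split).
Qed.

Lemma gen_split_dominates (t : J) :
  presentable kappa (osrc t) -> presentable kappa (otgt t) ->
  exists o (f : hom t (ob o)), True.
Proof.
move=> pS pT.
have [w [Qs Qt w_split [f _]]] :=
  split_dominates kappa_regular Q_presentable g_generates A_products m_pure pS pT.
by have [o oE] := ob_onto Qs Qt w_split; exists o; rewrite oE; exists f.
Qed.

Lemma gen_split_filtered : filtered kappa ob.
Proof.
move=> I N t s e a sI sN.
have [|w [Qs Qt [f fP]]] := over_presentable_cone kappa_regular Q_presentable
  g_generates (t := fun i => ob (t i)) a sI sN.
  by move=> i; split; exact: g_presentable.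
have [o [h _]] := gen_split_dominates (Q_presentable Qs) (Q_presentable Qt).
by exists o, (fun i => h \oc f i) => n; rewrite -composeA fP.
Qed.

Let P := node_poset kappa ob.
Let U : functor (poset_category P) J := node_functor kappa ob.
Let P_directed : directed kappa P :=
  node_poset_directed kappa_regular gen_split_filtered.

Let U_onto (t : J) :
  presentable kappa (osrc t) -> presentable kappa (otgt t) ->
  exists x (f : hom t (U x)), True.
Proof.
move=> pS pT; have [o [f _]] := gen_split_dominates pS pT.
have [x [r _]] := node_functor_surj kappa_regular ob o.
by exists x, (r \oc f).
Qed.

Let U_cofinal (t : J) (x : P) (s : hom (U x) t) :
  presentable kappa (osrc t) -> presentable kappa (otgt t) ->
  exists y (xy : ple x y) (r : hom t (U y)), trans U xy = r \oc s.
Proof.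
move=> pS pT; have [o [f _]] := gen_split_dominates pS pT.
have [y [xy [r rP]]] := node_functor_cofinal kappa_regular (f \oc s).
by exists y, xy, (r \oc f); rewrite -composeA.
Qed.

Let arrD := functor_compose (over_forget (Arrow m : arrow_category A)) U.
Let arrc : cocone arrD (Arrow m) := over_cocone U.

(** A map [a : Y -> C] from a generator is the source of a square from the
    identity of [Y] to [m], and so factors through the diagram.  Two maps into
    [U x] with equal composites to [C] are equalized by some [osrc (U x) -> X p]
    over [C]; pushing [U x] along this map, at a late enough stage over [D],
    gives an object over [m] under [U x], and cofinality applies. *)
Lemma over_arrow_src_colimit : is_colimit (cocone_map (src_functor A) arrc).
Proof.
apply: (dense_colimit kappa_regular Q_presentable (g_generates C) P_directed).
- by move=> x; exists (gsrc (ntop x).1).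
- move=> Y a QY; have pY := Q_presentable QY.
  have e : m \oc a \oc idm Y = m \oc a by rewrite compose_idr.
  have [x [f _]] := @U_onto (over_arrow_obj e) pY pY.
  by exists x, (ohom_src f); exact: (ohom_srcE f).
- move=> Y x a b QY ab; have pY := Q_presentable QY.
  have pS : presentable kappa (osrc (U x)) by exact: g_presentable.
  have pT : presentable kappa (otgt (U x)) by exact: g_presentable.
  have [R [R_dir [X [c [c_col XQ]]]]] := g_generates C.
  have [p [h [hP hab]]] := presentable_factor_equalize kappa_regular R_dir c_col pY pS ab.
  have [R' [R'_dir [X' [c' [c'_col X'Q]]]]] := g_generates D.
  have fg : m \oc leg c p \oc h = otgt_map (U x) \oc omor (U x).
    by rewrite omor_comm -composeA hP.
  have [q [m0 [k [mP kP mk]]]] := presentable_span kappa_regular R'_dir c'_col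
    pS (Q_presentable (XQ p)) pT fg.
  have [s [sE _]] := @over_arrow_hom _ _ _ m (U x) (over_arrow_obj mP) h k
    (esym mk) hP kP.
  have [y [xy [r rP]]] := U_cofinal s (Q_presentable (XQ p)) (Q_presentable (X'Q q)).
  exists y, xy.
  have -> : trans (functor_compose (src_functor A) arrD) xy = ohom_src r \oc h.
    by rewrite -sE; exact: (congr1 (@ohom_src _ _ _ _ _ _) rP).
  by rewrite -!composeA hab.
Qed.

(** As for sources, with two changes.  A map from a generator to [D] need not be
    the target of a square, so it is factored through a stage [X' q] over [D]
    that also receives some [X p] over [C], and [X p -> X' q] lies over [m].
    Two maps to be equalized are equalized on targets alone, keeping the
    source. *)
Lemma over_arrow_tgt_colimit : is_colimit (cocone_map (tgt_functor A) arrc).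
Proof.
have [R' [R'_dir [X' [c' [c'_col X'Q]]]]] := g_generates D.
apply: (dense_colimit kappa_regular Q_presentable (g_generates D) P_directed).
- by move=> x; exists (gtgt (ntop x).1).
- move=> Y b QY; have pY := Q_presentable QY.
  have [R [R_dir [X [c [c_col XQ]]]]] := g_generates C.
  have [p _] := directed_inhabited kappa_regular R_dir.
  have [q1 [m1 mP]] := presentable_factor R'_dir c'_col (Q_presentable (XQ p))
    (m \oc leg c p).
  have [q2 [b1 bP]] := presentable_factor R'_dir c'_col pY b.
  have [q l1 l2] := directed_bound2 kappa_regular R'_dir q1 q2.
  have e : leg c' q \oc (trans X' l1 \oc m1) = m \oc leg c p.
    by rewrite composeA leg_trans.
  have [x [f _]] := @U_onto (over_arrow_obj e) (Q_presentable (XQ p))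
    (Q_presentable (X'Q q)).
  exists x, (ohom_tgt f \oc (trans X' l2 \oc b1)).
  have fE : leg (cocone_map (tgt_functor A) arrc) x \oc ohom_tgt f = leg c' q.
    exact: (ohom_tgtE f).
  by rewrite composeA fE composeA leg_trans.
- move=> Y x a b QY ab; have pY := Q_presentable QY.
  have pS : presentable kappa (osrc (U x)) by exact: g_presentable.
  have pT : presentable kappa (otgt (U x)) by exact: g_presentable.
  have [q [h [hP hab]]] := presentable_factor_equalize kappa_regular R'_dir c'_col pY pT ab.
  have e : leg c' q \oc (h \oc omor (U x)) = m \oc osrc_map (U x).
    by rewrite composeA -omor_comm; congr (_ \oc _).
  have [s [_ sE]] := @over_arrow_hom _ _ _ m (U x) (over_arrow_obj e)
    (idm _) h (esym (compose_idr _)) (compose_idr _) hP.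
  have [y [xy [r rP]]] := U_cofinal s pS (Q_presentable (X'Q q)).
  exists y, xy.
  have -> : trans (functor_compose (tgt_functor A) arrD) xy = ohom_tgt r \oc h.
    rewrite -[X in _ = _ \oc X]sE.
    exact: (congr1 (@ohom_tgt _ _ _ _ _ _) rP).
  by rewrite -!composeA hab.
Qed.

Lemma pure_strongly_pure : strongly_pure_mono kappa m.
Proof.
exists P; split; first exact: P_directed.
exists arrD, arrc; split.
  apply: arrow_colimit; first exact: over_arrow_src_colimit.
  exact: over_arrow_tgt_colimit.
move=> x; split; first exact: (gsplit (ntop x).1).
by split; exact: g_presentable.
Qed.

End PureIsStronglyPure.

(** The given colimit is only known to be one in the arrow category; it is
    compared with the colimit computed at sources and targets, of which it is a
    retract. *)
Lemma strongly_pure_pure (kappa : SmallType) (A : category) (C D : A)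
    (m : hom C D) :
  regular_cardinal kappa -> has_directed_colimits kappa A ->
  strongly_pure_mono kappa m -> pure_mono kappa m.
Proof.
move=> kappa_regular A_colimits [P [P_dir [E [c [c_col E_split]]]]].
move=> S T pS pT t f d mf.
have [X [c' [src_col tgt_col]]] := arrow_colimit_exists
  (A_colimits P P_dir (functor_compose (src_functor A) E))
  (A_colimits P P_dir (functor_compose (tgt_functor A) E)).
have [v [w wv]] := colimit_retract c_col (arrow_colimit src_col tgt_col).
have [p [f1 f1P]] := presentable_factor P_dir src_col pS (sqsrc v \oc f).
have [q [d1 d1P]] := presentable_factor P_dir tgt_col pT (sqtgt v \oc d).
have [r pr qr] := directed_bound2 kappa_regular P_dir p q.
pose sE := functor_compose (src_functor A) E.
pose tE := functor_compose (tgt_functor A) E.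
have [f2 f2P] : exists f2 : hom S (asrc (E r)),
    sqsrc (leg c' r) \oc f2 = sqsrc v \oc f.
  exists (trans sE pr \oc f1).
  by rewrite -f1P composeA -(leg_trans (cocone_map (src_functor A) c') pr).
have [d2 d2P] : exists d2 : hom T (atgt (E r)),
    sqtgt (leg c' r) \oc d2 = sqtgt v \oc d.
  exists (trans tE qr \oc d1).
  by rewrite -d1P composeA -(leg_trans (cocone_map (tgt_functor A) c') qr).
have eq_r : leg (cocone_map (tgt_functor A) c') r \oc (amor (E r) \oc f2) =
            leg (cocone_map (tgt_functor A) c') r \oc (d2 \oc t).
  rewrite !composeA /= sq_comm d2P -!composeA f2P.
  by rewrite -mf !composeA (sq_comm v : sqtgt v \oc m = _).
have [u [ru e]] := presentable_equalize kappa_regular P_dir tgt_col pS eq_r.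
(* At stage [u] the square from [t] commutes, so the retraction of the split
   monomorphism there produces the diagonal. *)
have [s sP] := (E_split u).1.
exists (sqsrc w \oc sqsrc (leg c' u) \oc s \oc trans tE ru \oc d2).
rewrite -!composeA -e.
have -> : trans tE ru \oc (amor (E r) \oc f2) =
          amor (E u) \oc (trans sE ru \oc f2).
  by rewrite !composeA; congr (_ \oc _); exact: (sq_comm (trans E ru)).
rewrite (composeA s) sP compose_idl.
rewrite (composeA (sqsrc (leg c' u))).
have -> : sqsrc (leg c' u) \oc trans sE ru = sqsrc (leg c' r).
  exact: (leg_trans (cocone_map (src_functor A) c') ru).
rewrite f2P composeA.
have -> : sqsrc w \oc sqsrc v = idm C.
  exact: (congr1 (fun x : square (Arrow m) (Arrow m) => sqsrc x) wv).
exact: compose_idl.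
Qed.

Theorem corollary3p5 (kappa : SmallType) (A : category) :
  regular_cardinal kappa -> accessible kappa A -> has_finite_products A ->
  forall (C D : A) (m : hom C D),
    pure_mono kappa m <-> strongly_pure_mono kappa m.
Proof.
move=> kappa_regular [A_colimits [G [g [g_presentable g_generates]]]] A_products.
move=> C D m; split.
  exact: (pure_strongly_pure kappa_regular g_presentable g_generates A_products).
exact: strongly_pure_pure.
Qed.
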